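(* For every positive integer $k$, \[ \beta(2k) \;=\; \frac{(-1)^{k}\pi^{2k}}{2(2k-1)!}\int_0^{1/2}E_{2k-1}(t)\sec(\pi t)\,dt, \] where $E_{2k-1}(t)$ is the $(2k-1)$-th Euler polynomial.
   Context: The Dirichlet $\beta$-function is $\beta(s)=\sum_{m=0}^\infty \frac{(-1)^m}{(2m+1)^s}$. The Euler polynomials $E_k(x)$ are defined by the generating function $\sum_{k=0}^\infty E_k(x)\frac{t^k}{k!}=\frac{2e^{xt}}{e^t+1}$ (for $|t|<\pi$, $x\in\mathbb{R}$); e.g. $E_0(x)=1$, $E_1(x)=x-\tfrac12$, $E_3(x)=x^3-\tfrac32x^2+\tfrac14$. *)

(* Defs.v *)
From Stdlib Require Import Reals Factorial.
From Coquelicot Require Import Coquelicot.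
Open Scope R_scope.

(** [Rpower] is the real exponential; the base [2 m + 1] is always positive. *)
Definition beta_term (s : R) (m : nat) : R :=
  (-1) ^ m / Rpower (INR (2 * m + 1)) s.

Definition dirichlet_beta (s : R) : R := Series (beta_term s).

(** At a pole of the secant this returns [/ 0], an unspecified real.  In an
    integrand with one pole, at an endpoint, that value does not affect
    Riemann integrability or the integral. *)
Definition sec (x : R) : R := / cos x.

(** [E k x] is the value at [x] of the [k]-th Euler polynomial.  For each [x]
    the power series identity determines the whole sequence [E 0 x, E 1 x, ...],
    so at most one [E] satisfies this predicate. *)
Definition is_euler_polynomials (E : nat -> R -> R) : Prop :=
  forall x t : R, Rabs t < PI ->
    is_pseries (fun k => E k x / INR (fact k)) t
      (2 * exp (x * t) / (exp t + 1)).

(* Main.v *)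
(** Write [a_n = E_n / n!] and [w = (2 m + 1) pi].  Two integrations by parts give
    [int_0^(1/2) a_(2k-1)(t) cos (w t) dt = (-1)^k / w^(2k)]: the boundary terms
    vanish because [E_(2k-1)(1/2) = 0], [E_(2k-2)(0) = 0] for [k > 1], and
    [cos (w/2) = 0].  Summing against [(-1)^m] for [m <= N] turns the cosines into
    [sec (pi t) * (1 + (-1)^N cos ((2 N + 2) pi t)) / 2].  Since
    [a_(2k-1)(t) sec (pi t)] extends continuously to [1/2], the oscillating part
    tends to [0] by the Riemann-Lebesgue lemma, which proves both the convergence
    of the beta series and the formula for its sum, without any appeal to the
    convergence of the Fourier series of [E_(2k-1)]. *)

Require Import Defs.
From Stdlib Require Import Reals Factorial Lra Lia.
From Coquelicot Require Import Coquelicot.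
Open Scope R_scope.

(* [ring] and [lra] do not see through Coquelicot's coercions of [R] to its
   algebraic structures. *)
Ltac real_eq := match goal with |- ?u = ?v => change (@eq R u v) end.

(** * Power series: convergence radius and uniqueness of coefficients *)

Lemma is_pseries_le_CV_radius (a : nat -> R) (x l : R) :
  is_pseries a x l -> Rbar_le (Rabs x) (CV_radius a).
Proof.
  intros H. apply Rbar_not_lt_le. intros Hlt.
  apply (CV_disk_outside a x Hlt). apply ex_series_lim_0.
  exists l. now apply is_pseries_R.
Qed.

(** Convergence at [t] itself gives only a non-strict bound. The midpoint of [Rabs t] and [r] is a
    point of convergence strictly farther out, and makes the bound strict. *)
Lemma is_pseries_lt_CV_radius (a : nat -> R) (f : R -> R) (r : R) :
  (forall t, Rabs t < r -> is_pseries a t (f t)) ->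
  forall t, Rabs t < r -> Rbar_lt (Rabs t) (CV_radius a).
Proof.
  intros H t Ht.
  assert (Hm : Rabs ((Rabs t + r) / 2) = (Rabs t + r) / 2).
  { apply Rabs_pos_eq. pose proof (Rabs_pos t). lra. }
  apply Rbar_lt_le_trans with ((Rabs t + r) / 2).
  - simpl. lra.
  - rewrite <- Hm. apply is_pseries_le_CV_radius with (f ((Rabs t + r) / 2)).
    apply H. rewrite Hm. lra.
Qed.

(** The main tool for the Euler polynomials: two expansions of the same generating function are
    compared coefficient by coefficient. *)
Lemma is_pseries_coef_unique (a b : nat -> R) (f : R -> R) (r : R) :
  0 < r ->
  (forall t, Rabs t < r -> is_pseries a t (f t)) ->
  (forall t, Rabs t < r -> is_pseries b t (f t)) ->
  forall n, a n = b n.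
Proof.
  intros Hr Ha Hb n.
  assert (H0 : Rabs 0 < r) by (rewrite Rabs_R0; exact Hr).
  apply PSeries_ext_recip.
  - rewrite <- Rabs_R0. now apply (is_pseries_lt_CV_radius a f r).
  - rewrite <- Rabs_R0. now apply (is_pseries_lt_CV_radius b f r).
  - exists (mkposreal r Hr). intros t Ht.
    assert (Ht' : Rabs t < r).
    { replace t with (t - 0) by ring. exact Ht. }
    rewrite (is_pseries_unique _ _ _ (Ha t Ht')).
    now rewrite (is_pseries_unique _ _ _ (Hb t Ht')).
Qed.

Lemma is_pseries_alt (a : nat -> R) (t l : R) :
  is_pseries a (- t) l -> is_pseries (fun n => (-1) ^ n * a n) t l.
Proof.
  rewrite !is_pseries_R. apply is_series_ext. intros n. real_eq.
  replace (- t) with (-1 * t) by ring. rewrite Rpow_mult_distr. ring.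
Qed.

Lemma is_pseries_exp (x t : R) :
  is_pseries (fun n => x ^ n / INR (fact n)) t (exp (x * t)).
Proof.
  generalize (is_exp_Reals (x * t)). rewrite !is_pseries_R.
  apply is_series_ext. intros n. real_eq. rewrite Rpow_mult_distr. unfold Rdiv. ring.
Qed.

(** * Euler polynomials: symmetry, special values, derivative and cosine integrals *)

(** With the factorial divided out, differentiation becomes a pure index shift, and the integrations
    by parts produce no numerical factors. *)
Definition euler_coef (E : nat -> R -> R) (n : nat) (x : R) : R :=
  E n x / INR (fact n).

Section EulerCoef.

Variable E : nat -> R -> R.
Hypothesis hE : is_euler_polynomials E.

Let a := euler_coef E.

Lemma euler_coef_0 (x : R) : a 0%nat x = 1.
Proof.
  assert (H : is_pseries (fun k => a k x) 0 (2 * exp (x * 0) / (exp 0 + 1))).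
  { apply hE. rewrite Rabs_R0. exact PI_RGT_0. }
  apply is_pseries_unique in H. rewrite PSeries_0 in H.
  rewrite H, Rmult_0_r, exp_0. field.
Qed.

(** The generating function is invariant under replacing [(x, t)] by [(1 - x, - t)], as multiplying
    numerator and denominator by [exp t] shows. *)
Lemma euler_coef_reflection (n : nat) (x : R) :
  a n (1 - x) = (-1) ^ n * a n x.
Proof.
  revert n.
  apply (is_pseries_coef_unique _ _
           (fun t => 2 * exp ((1 - x) * t) / (exp t + 1)) PI PI_RGT_0).
  - intros t Ht. now apply hE.
  - intros t Ht. apply is_pseries_alt.
    replace (2 * exp ((1 - x) * t) / (exp t + 1))
      with (2 * exp (x * - t) / (exp (- t) + 1)).
    { apply hE. now rewrite Rabs_Ropp. }
    replace ((1 - x) * t) with (t + x * - t) by ring.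
    rewrite exp_plus, (exp_Ropp t). pose proof (exp_pos t). field. lra.
Qed.

(** The generating functions at 0 and 1 add up to the constant 2, whose coefficients of positive
    index vanish. *)
Lemma euler_coef_0_plus_1 (n : nat) : a (S n) 0 + a (S n) 1 = 0.
Proof.
  set (two := fun k : nat => if Nat.eqb k 0 then 2 else 0).
  change (a (S n) 0 + a (S n) 1 = two (S n)).
  generalize (S n).
  apply (is_pseries_coef_unique _ _ (fun _ => 2) PI PI_RGT_0).
  - intros t Ht.
    replace 2 with (plus (2 * exp (0 * t) / (exp t + 1))
                         (2 * exp (1 * t) / (exp t + 1))).
    + apply (is_pseries_plus (fun k => a k 0) (fun k => a k 1)); now apply hE.
    + change plus with Rplus. rewrite Rmult_0_l, Rmult_1_l, exp_0.
      pose proof (exp_pos t). real_eq. field. lra.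
  - intros t _. apply is_pseries_R.
    (* Every partial sum of the series with coefficients [two] already equals 2. *)
    apply filterlim_ext with (fun _ : nat => 2).
    + intros N. induction N as [|N IH].
      * rewrite sum_O. unfold two; simpl. real_eq. ring.
      * rewrite sum_Sn, <- IH. change plus with Rplus. unfold two; simpl.
        real_eq. ring.
    + apply filterlim_const.
Qed.

(** For an even index, reflection makes the values at 0 and 1 equal; for a positive index they are
    opposite. *)
Lemma euler_coef_even_at_0 (k : nat) : (0 < k)%nat -> a (2 * k) 0 = 0.
Proof.
  intros hk.
  pose proof (euler_coef_reflection (2 * k) 0) as H1.
  rewrite pow_1_even, Rminus_0_r in H1.
  pose proof (euler_coef_0_plus_1 (2 * k - 1)) as H2.
  replace (S (2 * k - 1)) with (2 * k)%nat in H2 by lia. lra.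
Qed.

(** The point 1/2 is fixed by the reflection, which changes the sign for an odd index. *)
Lemma euler_coef_odd_at_half (k : nat) : a (S (2 * k)) (1 / 2) = 0.
Proof.
  pose proof (euler_coef_reflection (S (2 * k)) (1 / 2)) as H.
  rewrite pow_1_odd in H. replace (1 - 1 / 2) with (1 / 2) in H by field. lra.
Qed.

(** This is the Cauchy product of [exp (x * t)] with the generating function at 0. The defining
    predicate treats each [x] separately; this formula supplies the polynomial dependence on [x],
    hence differentiability. *)
Lemma euler_coef_taylor (n : nat) (x : R) :
  a n x = sum_n (fun k => x ^ k / INR (fact k) * a (n - k)%nat 0) n.
Proof.
  rewrite sum_n_Reals. revert n.
  apply (is_pseries_coef_unique _
           (PS_mult (fun k => x ^ k / INR (fact k)) (fun k => a k 0))
           (fun t => 2 * exp (x * t) / (exp t + 1)) PI PI_RGT_0).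
  - intros t Ht. now apply hE.
  - intros t Ht.
    replace (2 * exp (x * t) / (exp t + 1))
      with (exp (x * t) * (2 * exp (0 * t) / (exp t + 1))).
    + apply is_pseries_mult.
      * apply is_pseries_exp.
      * now apply hE.
      * apply (is_pseries_lt_CV_radius _ (fun t => exp (x * t)) PI).
        -- intros; apply is_pseries_exp.
        -- exact Ht.
      * apply (is_pseries_lt_CV_radius _
                 (fun t => 2 * exp (0 * t) / (exp t + 1)) PI).
        -- intros; now apply hE.
        -- exact Ht.
    + rewrite Rmult_0_l, exp_0. pose proof (exp_pos t). field. lra.
Qed.

Lemma is_derive_euler_coef (n : nat) (x : R) :
  is_derive (a (S n)) x (a n x).
Proof.
  apply is_derive_ext with
    (fun y => sum_n (fun k => y ^ k / INR (fact k) * a (S n - k)%nat 0) (S n)).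
  { intros y. symmetry. apply euler_coef_taylor. }
  replace (a n x) with
    (sum_n (fun k => (INR k * x ^ pred k) / INR (fact k) * a (S n - k)%nat 0)
           (S n)).
  { apply (is_derive_sum_n (fun k y => y ^ k / INR (fact k) * a (S n - k)%nat 0)).
    intros k _. generalize (S n - k)%nat. intros j.
    auto_derive; [exact I|]. unfold Rdiv. ring. }
  (* The term of index 0 has the factor [INR 0]; the others are shifted down by one, using k / k! =
     1 / (k-1)!. *)
  rewrite (euler_coef_taylor n x). unfold sum_n.
  rewrite sum_Sn_m, <- sum_n_m_S by lia.
  change plus with Rplus. simpl INR at 1. unfold Rdiv at 1.
  rewrite !Rmult_0_l, Rplus_0_l. apply sum_n_m_ext. intros k.
  rewrite Nat.sub_succ. f_equal. simpl pred. rewrite fact_simpl, mult_INR.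
  field. split; apply not_0_INR; [apply fact_neq_0 | lia].
Qed.

Lemma Derive_euler_coef (n : nat) (x : R) :
  Derive (fun y : R => a (S n) y) x = a n x.
Proof. apply is_derive_unique, is_derive_euler_coef. Qed.

Lemma continuous_euler_coef (n : nat) (x : R) : continuous (a n) x.
Proof.
  destruct n as [|n].
  - apply continuous_ext with (fun _ => 1).
    + intros y. symmetry. apply euler_coef_0.
    + apply continuous_const.
  - apply (ex_derive_continuous (a (S n))). eexists. apply is_derive_euler_coef.
Qed.

(** Induction on [k]: each step is a double integration by parts, which multiplies the integral by
    -1 / w^2. *)
Lemma is_RInt_euler_coef_cos (k : nat) (w : R) :
  w <> 0 -> cos (w * (1 / 2)) = 0 ->
  is_RInt (fun t => a (S (2 * k)) t * cos (w * t)) 0 (1 / 2)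
    ((-1) ^ S k / w ^ (2 * S k)).
Proof.
  intros Hw Hc.
  assert (Hcos : forall t, continuous (fun t => cos (w * t)) t).
  { intros t. apply (ex_derive_continuous (fun t => cos (w * t))).
    auto_derive; auto. }
  induction k as [|k IH].
  (* Since a_0 = 1, the two sine terms in the derivative of [F] cancel. Here F(1/2) = 0 and F(0) = 1
     / w^2. *)
  - set (F := fun t => a 1%nat t * sin (w * t) / w + cos (w * t) / w ^ 2).
    replace ((-1) ^ 1 / w ^ (2 * 1)) with (minus (F (1 / 2)) (F 0)).
    + apply (is_RInt_derive F).
      * intros t _. unfold F. auto_derive.
        -- exists (a 0%nat t). apply is_derive_euler_coef.
        -- rewrite Derive_euler_coef, euler_coef_0. simpl. real_eq. field. exact Hw.
      * intros t _. apply (continuous_mult (a 1%nat)); [|apply Hcos].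
        apply continuous_euler_coef.
    + change (F (1 / 2) - F 0 = (-1) ^ 1 / w ^ (2 * 1)). unfold F.
      replace (a 1%nat (1 / 2)) with 0
        by (symmetry; apply (euler_coef_odd_at_half 0)).
      rewrite Hc, Rmult_0_r, sin_0, cos_0. simpl. field. exact Hw.
  - set (n := S (2 * k)) in *.
    replace (S (2 * S k)) with (S (S n)) by (unfold n; lia).
    (* Both integrations by parts are packed into one antiderivative [F] of [f]: the terms a_(n+1)
       sin (w t) / w cancel. [F] vanishes at both endpoints. *)
    set (F := fun t => a (S (S n)) t * sin (w * t) / w
                       + a (S n) t * cos (w * t) / w ^ 2).
    set (f := fun t => a (S (S n)) t * cos (w * t)
                       + a n t * cos (w * t) / w ^ 2).
    assert (HF : is_RInt f 0 (1 / 2) 0).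
    { replace 0 with (minus (F (1 / 2)) (F 0)) at 2.
      - apply (is_RInt_derive F f).
        + intros t _. unfold F, f. auto_derive.
          * repeat split; [exists (a (S n) t) | exists (a n t)];
              apply is_derive_euler_coef.
          * rewrite !Derive_euler_coef. real_eq. field. exact Hw.
        + intros t _. unfold f.
          apply (continuous_plus (fun t => a (S (S n)) t * cos (w * t))).
          * apply (continuous_mult (a (S (S n)))); [|apply Hcos].
            apply continuous_euler_coef.
          * apply (continuous_mult (fun t => a n t * cos (w * t)));
              [|apply continuous_const].
            apply (continuous_mult (a n)); [|apply Hcos].
            apply continuous_euler_coef.
      - change (F (1 / 2) - F 0 = 0). unfold F.
        replace (S (S n)) with (S (2 * S k)) by (unfold n; lia).
        replace (S n) with (2 * S k)%nat by (unfold n; lia).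
        rewrite Hc, euler_coef_odd_at_half, euler_coef_even_at_0 by lia.
        rewrite !Rmult_0_r, sin_0. field. exact Hw. }
    apply is_RInt_ext with
      (fun t => minus (f t) (scal (/ w ^ 2) (a n t * cos (w * t)))).
    { intros t _. unfold f, minus, plus, opp, scal; simpl; unfold mult; simpl.
      real_eq. field. exact Hw. }
    replace ((-1) ^ S (S k) / w ^ (2 * S (S k)))
      with (minus 0 (scal (/ w ^ 2) ((-1) ^ S k / w ^ (2 * S k)))).
    + apply (is_RInt_minus f); [exact HF|].
      now apply (is_RInt_scal (fun t => a n t * cos (w * t))).
    + replace (2 * S (S k))%nat with (2 * S k + 2)%nat by lia.
      rewrite pow_add, <- (tech_pow_Rmult (-1) (S k)).
      set (m := (2 * S k)%nat).
      unfold minus, plus, opp, scal; simpl; unfold mult; simpl.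
      real_eq. field. split; [exact Hw | now apply pow_nonzero].
Qed.

End EulerCoef.

(** * A Riemann-Lebesgue lemma *)

(* [dg] may be unbounded near [b], so integration by parts is used only up to
   some [c < b]; on [c, b] the integrand is bounded and the interval is short. *)
Lemma riemann_lebesgue_cos (g dg : R -> R) (a b : R) :
  a < b ->
  (forall t, a <= t <= b -> continuous g t) ->
  (forall t, a <= t < b -> is_derive g t (dg t)) ->
  (forall t, a <= t < b -> continuous dg t) ->
  is_lim (fun w => RInt (fun t => g t * cos (w * t)) a b) p_infty 0.
Proof.
  intros Hab Hg Hd Hdc.
  assert (Hcos : forall w t, continuous (fun t => cos (w * t)) t).
  { intros w t. apply (ex_derive_continuous (fun t => cos (w * t))).
    auto_derive; auto. }
  assert (Hsin : forall w t, continuous (fun t => sin (w * t)) t).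
  { intros w t. apply (ex_derive_continuous (fun t => sin (w * t))).
    auto_derive; auto. }
  destruct (bounded_continuity g a b Hg) as [M HM].
  assert (HM' : forall t, a <= t <= b -> Rabs (g t) <= M).
  { intros t Ht. left. exact (HM t Ht). }
  assert (HMpos : 0 < M).
  { apply Rle_lt_trans with (norm (g a)); [apply norm_ge_0 | apply HM; lra]. }
  apply is_lim_spec. intros eps.
  (* [d] is the length of the final piece: the first bound keeps [c] in [[a, b]], the second makes
     that piece contribute at most [eps / 2]. *)
  set (d := Rmin (b - a) (eps / (2 * M))).
  assert (Hd0 : 0 < d).
  { apply Rmin_pos; [lra|]. apply Rdiv_lt_0_compat; [apply cond_pos | lra]. }
  assert (Hd1 : d <= b - a) by apply Rmin_l.
  assert (Hd2 : d * M <= eps / 2).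
  { replace (eps / 2) with (eps / (2 * M) * M) by (field; lra).
    apply Rmult_le_compat_r; [lra | apply Rmin_r]. }
  set (c := b - d).
  destruct (bounded_continuity dg a c) as [M' HM1].
  { intros t Ht. apply Hdc. unfold c in Ht. lra. }
  (* [K] bounds the two boundary terms plus the integral of [dg t * sin (w * t)], uniformly in [w].
     The integral over [[a, c]] is thus at most [K / w], which explains the threshold
     [2 * K / eps]. *)
  set (K := 2 * M + (c - a) * M').
  assert (HK : 0 <= K).
  { assert (0 <= M').
    { apply Rle_trans with (norm (dg a)); [apply norm_ge_0|].
      left. apply HM1. unfold c; lra. }
    assert (0 <= (c - a) * M') by (apply Rmult_le_pos; unfold c; lra).
    unfold K. lra. }
  exists (2 * K / eps). intros w Hw.
  assert (He : 0 < eps) by apply cond_pos.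
  assert (Hw0 : 0 < w).
  { apply Rle_lt_trans with (2 := Hw).
    apply Rmult_le_pos; [lra | left; now apply Rinv_0_lt_compat]. }
  set (f := fun t => g t * cos (w * t)).
  assert (Hf : forall t, a <= t <= b -> continuous f t).
  { intros t Ht. apply (continuous_mult g); [now apply Hg | apply Hcos]. }
  assert (Hac : ex_RInt f a c).
  { apply (ex_RInt_continuous f). intros t Ht. apply Hf.
    rewrite Rmin_left, Rmax_right in Ht by (unfold c; lra). unfold c in Ht. lra. }
  assert (Hcb : ex_RInt f c b).
  { apply (ex_RInt_continuous f). intros t Ht. apply Hf.
    rewrite Rmin_left, Rmax_right in Ht by (unfold c; lra). unfold c in Ht. lra. }
  rewrite Rminus_0_r, <- (RInt_Chasles f a c b Hac Hcb).
  assert (Hnear : Rabs (RInt f c b) <= eps / 2).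
  { apply Rle_trans with ((b - c) * M).
    - apply abs_RInt_le_const; [unfold c; lra | exact Hcb |].
      intros t Ht. unfold f. rewrite Rabs_mult, <- (Rmult_1_r M).
      apply Rmult_le_compat; try apply Rabs_pos.
      + apply HM'. unfold c in Ht. lra.
      + apply Rabs_le. pose proof (COS_bound (w * t)). lra.
    - replace (b - c) with d by (unfold c; ring). exact Hd2. }
  assert (Hfar : Rabs (RInt f a c) < eps / 2).
  { set (s := fun t => dg t * sin (w * t)).
    set (F := fun t => g t * sin (w * t)).
    assert (Hs : ex_RInt s a c).
    { apply (ex_RInt_continuous s). intros t Ht.
      rewrite Rmin_left, Rmax_right in Ht by (unfold c; lra).
      apply (continuous_mult dg); [apply Hdc; unfold c in Ht; lra | apply Hsin]. }
    assert (HF : is_RInt (fun t => s t + w * f t) a c (minus (F c) (F a))).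
    { apply (is_RInt_derive F (fun t => s t + w * f t)); intros t Ht;
        rewrite Rmin_left, Rmax_right in Ht by (unfold c; lra).
      - unfold F, s, f. assert (Ht' : a <= t < b) by (unfold c in Ht; lra).
        auto_derive.
        + exists (dg t). now apply Hd.
        + replace (Derive (fun x : R => g x) t) with (dg t).
          { real_eq. ring. }
          symmetry. apply is_derive_unique. now apply Hd.
      - apply (continuous_plus s).
        + apply (continuous_mult dg);
            [apply Hdc; unfold c in Ht; lra | apply Hsin].
        + apply (continuous_mult (fun _ => w)); [apply continuous_const|].
          apply Hf. unfold c in Ht. lra. }
    assert (Hpart : RInt s a c + w * RInt f a c = F c - F a).
    { rewrite <- (is_RInt_unique (fun t => s t + w * f t) a c (F c - F a) HF).
      symmetry. apply (is_RInt_unique (fun t => s t + w * f t)).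
      apply (is_RInt_plus s); [now apply (RInt_correct s)|].
      apply (is_RInt_scal f). now apply (RInt_correct f). }
    assert (HFb : forall t, a <= t <= b -> Rabs (F t) <= M).
    { intros t Ht. unfold F. rewrite Rabs_mult, <- (Rmult_1_r M).
      apply Rmult_le_compat; try apply Rabs_pos; [now apply HM'|].
      apply Rabs_le. pose proof (SIN_bound (w * t)). lra. }
    assert (Hsb : Rabs (RInt s a c) <= (c - a) * M').
    { apply abs_RInt_le_const; [unfold c; lra | exact Hs |].
      intros t Ht. unfold s. rewrite Rabs_mult, <- (Rmult_1_r M').
      apply Rmult_le_compat; try apply Rabs_pos.
      - left. exact (HM1 t Ht).
      - apply Rabs_le. pose proof (SIN_bound (w * t)). lra. }
    assert (HwI : w * Rabs (RInt f a c) <= K).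
    { rewrite <- (Rabs_pos_eq w) at 1 by lra. rewrite <- Rabs_mult.
      replace (w * RInt f a c) with (F c - F a - RInt s a c) by lra.
      pose proof (HFb a ltac:(lra)). pose proof (HFb c ltac:(unfold c; lra)).
      apply Rabs_le. unfold K.
      apply Rabs_le_between in Hsb, H, H0. lra. }
    apply Rmult_lt_reg_l with w; [exact Hw0|].
    apply Rle_lt_trans with (1 := HwI).
    apply Rmult_lt_compat_r with (r := eps / 2) in Hw; [|lra].
    replace (2 * K / eps * (eps / 2)) with K in Hw by (field; lra). exact Hw. }
  change plus with Rplus.
  apply Rle_lt_trans with (1 := Rabs_triang _ _). lra.
Qed.

(** * Quotients with a removable singularity *)

Lemma continuous_slope (f : R -> R) (x l : R) :
  is_derive f x l -> f x = 0 ->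
  continuous (fun t => if Req_EM_T t x then l else f t / (t - x)) x.
Proof.
  intros Hf H0. apply is_derive_Reals in Hf.
  intros P [eps HP]. destruct (Hf eps (cond_pos eps)) as [d Hd].
  exists d. intros y Hy. apply HP.
  destruct (Req_EM_T x x) as [_|n]; [|now elim n].
  destruct (Req_EM_T y x) as [->|Hyx].
  - apply ball_center.
  - specialize (Hd (y - x) ltac:(lra) Hy).
    rewrite Rplus_minus in Hd.
    rewrite H0, Rminus_0_r in Hd. exact Hd.
Qed.

(** Intended for a common zero [x] of [f] and [g], with [l] the limit of the quotient there. *)
Definition quotient_ext (f g : R -> R) (x l t : R) : R :=
  if Req_EM_T t x then l else f t / g t.

(** L'Hopital's rule at a simple zero of [g]: write the quotient as a ratio of the slopes of [f] and
    [g] from [x], both continuous at [x] and the second nonzero there. *)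
Lemma continuous_quotient_ext (f g : R -> R) (x df dg : R) :
  is_derive f x df -> is_derive g x dg ->
  f x = 0 -> g x = 0 -> dg <> 0 ->
  continuous (quotient_ext f g x (df / dg)) x.
Proof.
  intros Hf Hg Hf0 Hg0 Hdg.
  set (q := fun (h : R -> R) (l t : R) =>
              if Req_EM_T t x then l else h t / (t - x)).
  assert (Hq : forall t : R,
            q f df t * / q g dg t = quotient_ext f g x (df / dg) t).
  { intros t. unfold q, quotient_ext. destruct (Req_EM_T t x) as [_|n]; [easy|].
    (* Inversion is total, so this cancellation also covers points [t] with [g t = 0]. *)
    unfold Rdiv. rewrite Rinv_mult, Rinv_inv.
    transitivity (f t * / g t * (/ (t - x) * (t - x))); [ring|].
    rewrite Rinv_l by lra. ring. }
  apply continuous_ext with (1 := Hq).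
  apply (continuous_mult (q f df)).
  - now apply continuous_slope.
  - apply (continuous_Rinv_comp (q g dg)); [now apply continuous_slope|].
    unfold q. destruct (Req_EM_T x x) as [_|n]; [exact Hdg | now elim n].
Qed.

Lemma locally_quotient_ext (f g : R -> R) (x l t : R) :
  t <> x -> locally t (fun y => f y / g y = quotient_ext f g x l y).
Proof.
  intros Htx.
  assert (Hp : 0 < Rabs (t - x)) by (apply Rabs_pos_lt; lra).
  exists (mkposreal _ Hp). intros y Hy. unfold quotient_ext.
  destruct (Req_EM_T y x) as [->|_]; [|reflexivity].
  exfalso. apply (Rlt_irrefl (Rabs (t - x))).
  rewrite <- (Rabs_minus_sym x t) at 1. exact Hy.
Qed.

(** * Finite sums of integrals and of cosines *)

Lemma is_RInt_sum_n (f : nat -> R -> R) (l : nat -> R) (a b : R) (N : nat) :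
  (forall m, is_RInt (f m) a b (l m)) ->
  is_RInt (fun t => sum_n (fun m => f m t) N) a b (sum_n l N).
Proof.
  intros H. induction N as [|N IH].
  - rewrite sum_O. apply is_RInt_ext with (f 0%nat); [|apply H].
    intros t _. now rewrite sum_O.
  - rewrite sum_Sn.
    apply is_RInt_ext with (fun t => plus (sum_n (fun m => f m t) N) (f (S N) t)).
    + intros t _. now rewrite sum_Sn.
    + now apply (is_RInt_plus (fun t => sum_n (fun m => f m t) N)).
Qed.

(** Since 2 cos x cos y = cos (y - x) + cos (y + x), the alternating sum telescopes. Keeping the
    factor [2 * cos x] on the left avoids a division. *)
Lemma sum_alternating_cos (N : nat) (x : R) :
  sum_n (fun m => (-1) ^ m * cos (INR (2 * m + 1) * x)) N * (2 * cos x) =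
  1 + (-1) ^ N * cos (INR (2 * N + 2) * x).
Proof.
  induction N as [|N IH].
  - rewrite sum_O. simpl.
    replace ((1 + 1) * x) with (2 * x) by ring.
    rewrite !Rmult_1_l, cos_2a_cos. ring.
  - rewrite sum_Sn. change plus with Rplus.
    rewrite Rmult_plus_distr_r, IH, <- tech_pow_Rmult.
    set (y := INR (2 * S N + 1) * x).
    replace (INR (2 * N + 2) * x) with (y - x)
      by (unfold y; rewrite !plus_INR, !mult_INR, !S_INR; simpl; ring).
    replace (INR (2 * S N + 2) * x) with (y + x)
      by (unfold y; rewrite !plus_INR, !mult_INR, !S_INR; simpl; ring).
    rewrite cos_minus, cos_plus. ring.
Qed.

Lemma cos_half_odd_PI (m : nat) : cos (INR (2 * m + 1) * PI * (1 / 2)) = 0.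
Proof.
  replace (INR (2 * m + 1) * PI * (1 / 2)) with (PI / 2 + INR m * PI)
    by (rewrite plus_INR, mult_INR; simpl; field).
  induction m as [|m IH].
  - simpl. rewrite Rmult_0_l, Rplus_0_r. apply cos_PI2.
  - rewrite S_INR.
    replace (PI / 2 + (INR m + 1) * PI) with (PI / 2 + INR m * PI + PI) by ring.
    rewrite neg_cos, IH. ring.
Qed.

(** * The beta series and the secant integral *)

Theorem theorem1p3 (E : nat -> R -> R) (hE : is_euler_polynomials E)
    (k : nat) (hk : (0 < k)%nat) :
  ex_series (beta_term (INR (2 * k))) /\
  ex_RInt (fun t => E (2 * k - 1)%nat t * sec (PI * t)) 0 (1 / 2) /\
  dirichlet_beta (INR (2 * k)) =
    (-1) ^ k * PI ^ (2 * k) / (2 * INR (fact (2 * k - 1))) *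
      RInt (fun t => E (2 * k - 1)%nat t * sec (PI * t)) 0 (1 / 2).
Proof.
  destruct k as [|j]; [lia|].
  replace (2 * S j - 1)%nat with (S (2 * j)) by lia.
  set (n := S (2 * j)).
  pose proof PI_RGT_0 as Hpi.
  set (A := euler_coef E n).
  set (B := euler_coef E (2 * j)).
  set (c := fun t => cos (PI * t)).
  assert (Hc : forall t, is_derive c t (- PI * sin (PI * t))).
  { intros t. unfold c. auto_derive; [exact I|]. real_eq. ring. }
  assert (HA : forall t, is_derive A t (B t)).
  { intros t. now apply is_derive_euler_coef. }
  assert (HcA : forall t, continuous A t).
  { intros t. now apply continuous_euler_coef. }
  assert (HcB : forall t, continuous B t).
  { intros t. now apply continuous_euler_coef. }
  assert (Hcc : forall t, continuous c t).
  { intros t. apply (ex_derive_continuous c). eexists. apply Hc. }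
  assert (Hpos : forall t, 0 <= t < 1 / 2 -> 0 < c t).
  { intros t Ht. apply cos_gt_0; nra. }
  (* The continuous extension of [A t * sec (PI * t)]; its value at 1/2 is the ratio of the
     derivatives of [A] and [c]. *)
  set (h := quotient_ext A c (1 / 2) (B (1 / 2) / (- PI * sin (PI * (1 / 2))))).
  assert (Hh : forall t, 0 <= t < 1 / 2 -> h t = A t / c t).
  { intros t Ht. unfold h, quotient_ext.
    destruct (Req_EM_T t (1 / 2)); [lra | reflexivity]. }
  set (dh := fun t => (B t * c t + PI * A t * sin (PI * t)) / c t ^ 2).
  assert (Hdh : forall t, 0 <= t < 1 / 2 -> is_derive h t (dh t)).
  { intros t Ht. pose proof (Hpos t Ht).
    apply is_derive_ext_loc with (fun y => A y / c y).
    { apply locally_quotient_ext. lra. }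
    replace (dh t) with ((B t * c t - A t * (- PI * sin (PI * t))) / c t ^ 2)
      by (unfold dh; f_equal; ring).
    apply is_derive_div; [apply HA | apply Hc | lra]. }
  assert (Hch : forall t, 0 <= t <= 1 / 2 -> continuous h t).
  { intros t Ht. destruct (Req_EM_T t (1 / 2)) as [->|Hne].
    - apply continuous_quotient_ext; [apply HA | apply Hc | | |].
      + now apply euler_coef_odd_at_half.
      + unfold c. replace (PI * (1 / 2)) with (PI / 2) by field. apply cos_PI2.
      + replace (PI * (1 / 2)) with (PI / 2) by field. rewrite sin_PI2. lra.
    - apply (ex_derive_continuous h). exists (dh t). apply Hdh. lra. }
  assert (Hcdh : forall t, 0 <= t < 1 / 2 -> continuous dh t).
  { intros t Ht. pose proof (Hpos t Ht).
    apply (continuous_mult (fun t => B t * c t + PI * A t * sin (PI * t))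
                           (fun t => / c t ^ 2)).
    - apply (continuous_plus (fun t => B t * c t)).
      + now apply (continuous_mult B c).
      + apply (continuous_mult (fun t => PI * A t)).
        * apply (continuous_mult (fun _ => PI)); [apply continuous_const | easy].
        * apply (ex_derive_continuous (fun t => sin (PI * t))). auto_derive; easy.
    - apply (continuous_Rinv_comp (fun t => c t ^ 2)).
      + apply (ex_derive_continuous (fun t => c t ^ 2)).
        unfold c. auto_derive; easy.
      + apply pow_nonzero. lra. }
  set (f := fun w t => h t * cos (w * t)).
  assert (Hf : forall w, ex_RInt (f w) 0 (1 / 2)).
  { intros w. apply (ex_RInt_continuous (f w)). intros t Ht.
    rewrite Rmin_left, Rmax_right in Ht by lra.
    apply (continuous_mult h); [now apply Hch|].
    apply (ex_derive_continuous (fun t => cos (w * t))). auto_derive; easy. }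
  assert (Hhint : ex_RInt h 0 (1 / 2)).
  { apply (ex_RInt_continuous h). intros t Ht.
    rewrite Rmin_left, Rmax_right in Ht by lra. now apply Hch. }
  pose proof (riemann_lebesgue_cos h dh 0 (1 / 2) ltac:(lra) Hch Hdh Hcdh) as HRL.
  set (J := RInt h 0 (1 / 2)).
  (* The frequency of the oscillating term in [sum_alternating_cos] at [PI * t]. *)
  set (w := fun N => INR (2 * N + 2) * PI).
  set (r := fun N => RInt (f (w N)) 0 (1 / 2)).
  assert (Hr : is_lim_seq r 0).
  { apply (is_lim_comp_seq _ w p_infty 0 HRL).
    - exists 0%nat. easy.
    - apply is_lim_seq_le_p_loc with INR; [|apply is_lim_seq_INR].
      exists 0%nat. intros N _. unfold w. rewrite plus_INR, mult_INR. simpl.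
      pose proof (pos_INR N). pose proof PI2_1. nra. }
  (* The alternating cosine integrals of [A]. Multiplying [s m] by [(-1) ^ S j * PI ^ (2 * S j)]
     gives the beta term. *)
  set (s := fun m => (-1) ^ m * ((-1) ^ S j / (INR (2 * m + 1) * PI) ^ (2 * S j))).
  (* One integral is evaluated twice: term by term ([H1]), and through the closed form of the cosine
     sum ([H2]). *)
  assert (Hs : forall N, sum_n s N = 1 / 2 * (J + (-1) ^ N * r N)).
  { intros N.
    assert (Hodd : forall m, INR (2 * m + 1) <> 0)
      by (intros m; apply not_0_INR; lia).
    assert (H1 : is_RInt (fun t => sum_n (fun m => (-1) ^ m *
                     (A t * cos (INR (2 * m + 1) * PI * t))) N) 0 (1 / 2)
                   (sum_n s N)).
    { apply is_RInt_sum_n. intros m.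
      apply (is_RInt_scal (fun t => A t * cos (INR (2 * m + 1) * PI * t))).
      apply is_RInt_euler_coef_cos; [exact hE | | apply cos_half_odd_PI].
      apply Rmult_integral_contrapositive_currified; [apply Hodd | lra]. }
    assert (H2 : is_RInt (fun t => 1 / 2 * (h t + (-1) ^ N * f (w N) t))
                   0 (1 / 2) (1 / 2 * (J + (-1) ^ N * r N))).
    { apply (is_RInt_scal (fun t => h t + (-1) ^ N * f (w N) t)).
      apply (is_RInt_plus h); [now apply (RInt_correct h)|].
      apply (is_RInt_scal (f (w N))). now apply (RInt_correct (f (w N))). }
    rewrite <- (is_RInt_unique (V := R_CompleteNormedModule) _ _ _ _ H1).
    apply (is_RInt_unique (V := R_CompleteNormedModule)).
    (* The integrands need to agree only on the open interval, where [c t] is positive and [2 * c t]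
       may be cancelled. *)
    revert H2. apply is_RInt_ext. intros t Ht.
    rewrite Rmin_left, Rmax_right in Ht by lra.
    pose proof (Hpos t ltac:(lra)) as Hct.
    unfold f. rewrite (Hh t) by lra.
    rewrite (sum_n_ext _ (fun m => scal (A t)
               ((-1) ^ m * cos (INR (2 * m + 1) * (PI * t))))).
    - rewrite sum_n_scal_l. change (@scal R_Ring R_ModuleSpace) with Rmult.
      pose proof (sum_alternating_cos N (PI * t)) as HD.
      fold (c t) in HD. unfold w.
      replace (INR (2 * N + 2) * PI * t) with (INR (2 * N + 2) * (PI * t)) by ring.
      apply Rmult_eq_reg_r with (2 * c t); [|lra].
      rewrite (Rmult_assoc (A t)).
      etransitivity; [|symmetry; exact (f_equal (Rmult (A t)) HD)]. real_eq. field. lra.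
    - intros m. unfold scal; simpl; unfold mult; simpl. rewrite Rmult_assoc.
      real_eq. ring. }
  assert (Hbeta : is_series (beta_term (INR (2 * S j)))
                    ((-1) ^ S j * PI ^ (2 * S j) * (1 / 2 * J))).
  { apply filterlim_ext with
      (fun N => (-1) ^ S j * PI ^ (2 * S j) * (1 / 2 * (J + (-1) ^ N * r N))).
    - intros N. rewrite <- Hs.
      change (scal ((-1) ^ S j * PI ^ (2 * S j)) (sum_n s N)
              = sum_n (beta_term (INR (2 * S j))) N).
      etransitivity;
        [symmetry; apply (sum_n_scal_l (K := R_Ring) (V := R_ModuleSpace))|].
      apply sum_n_ext. intros m.
      unfold beta_term, s.
      assert (Hm : 0 < INR (2 * m + 1)) by (apply lt_0_INR; lia).
      rewrite Rpower_pow, Rpow_mult_distr by exact Hm.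
      assert (Hsq : (-1) ^ S j * (-1) ^ S j = 1).
      { rewrite <- Rpow_mult_distr. replace (-1 * -1) with 1 by ring.
        apply pow1. }
      change (@scal R_Ring R_ModuleSpace) with Rmult.
      set (u := INR (2 * m + 1) ^ (2 * S j)). set (v := PI ^ (2 * S j)).
      assert (u <> 0) by (apply pow_nonzero; lra).
      assert (v <> 0) by (apply pow_nonzero; lra).
      set (e := (-1) ^ S j) in *. real_eq.
      transitivity (e * e * ((-1) ^ m / u)); [field; auto|].
      rewrite Hsq. ring.
    - apply (is_lim_seq_scal_l (fun N => 1 / 2 * (J + (-1) ^ N * r N)) _ (1 / 2 * J)).
      apply (is_lim_seq_scal_l (fun N => J + (-1) ^ N * r N) _ J).
      replace (Finite J) with (Finite (J + 0)) by (f_equal; ring).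
      apply is_lim_seq_plus'; [apply is_lim_seq_const|].
      (* The sign [(-1) ^ N] disappears in absolute value, so the limit of [r] suffices. *)
      apply is_lim_seq_abs_0.
      apply is_lim_seq_ext with (fun N => Rabs (r N)).
      + intros N. rewrite Rabs_mult, pow_1_abs. ring.
      + now apply (proj1 (is_lim_seq_abs_0 r)). }
  assert (Hint : is_RInt (fun t => E n t * sec (PI * t)) 0 (1 / 2)
                   (INR (fact n) * J)).
  { apply is_RInt_ext with (fun t => scal (INR (fact n)) (h t)).
    - intros t Ht. rewrite Rmin_left, Rmax_right in Ht by lra.
      rewrite (Hh t) by lra. unfold A, euler_coef, sec, c.
      change (@scal R_Ring R_ModuleSpace) with Rmult.
      pose proof (Hpos t ltac:(lra)) as Hct. unfold c in Hct.
      real_eq. field. split; [lra | apply INR_fact_neq_0].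
    - apply (is_RInt_scal h). now apply (RInt_correct h). }
  split; [eexists; exact Hbeta|].
  split; [eexists; exact Hint|].
  rewrite (is_RInt_unique _ _ _ _ Hint).
  unfold dirichlet_beta. rewrite (is_series_unique _ _ Hbeta).
  field. apply INR_fact_neq_0.
Qed.
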